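(* The function $\alpha$ is in the Zygmund class $\Lambda_1$; that is, there is $C>0$ such that $$|\alpha(x+h)+\alpha(x-h)-2\alpha(x)|\le C|h|$$ for all $x\in\mathbb{S}^1$ and all $h\in\mathbb{R}$ with $|h|\le 1$.
   Context: Identify $\mathbb{S}^1$ with $\mathbb{R}/\mathbb{Z}$ via $t\mapsto(\cos 2\pi t,\sin 2\pi t)$; functions on $\mathbb{S}^1$ are identified with $1$-periodic functions on $\mathbb{R}$, so $x+h$ makes sense for $x\in\mathbb{S}^1$, $h\in\mathbb{R}$. Fix $\epsilon\in(0,1)$; $C^{k+\epsilon}$ means $C^k$ with $\epsilon$-Hölder $k$-th derivative. Let $f:\mathbb{S}^1\to\mathbb{S}^1$ be a $C^{2+\epsilon}$ expanding map, i.e. there is $\lambda>1$ with $|Df(x)|>\lambda$ for every $x$, and let $v:\mathbb{S}^1\to\mathbb{R}$ be a $C^{1+\epsilon}$ function. The generalized Weierstrass function $\alpha:\mathbb{S}^1\to\mathbb{R}$ is $$\alpha(y)=-\sum_{n=1}^{\infty}\frac{v(f^{n-1}(y))}{Df^n(y)},$$ where $f^n$ is the $n$-th iterate of $f$; it is the unique bounded solution of $v(x)=\alpha(f(x))-Df(x)\alpha(x)$. *)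

(* Defs.v *)
From HB Require Import structures.
From mathcomp Require Import all_boot all_order all_algebra.
From mathcomp Require Import generic_quotient ring_quotient.
From mathcomp Require Import all_classical all_reals all_analysis.
From mathcomp Require Import lra.
Import Order.TTheory GRing.Theory Num.Theory numFieldNormedType.Exports.

Set Implicit Arguments.
Unset Strict Implicit.
Unset Printing Implicit Defensive.

Local Open Scope classical_set_scope.
Local Open Scope quotient_scope.
Local Open Scope ring_scope.

(* Num.int_num_subdef is the boolean predicate behind the qualifier Num.int. *)
Definition int_subgroup (R : realType) : zmodClosed R :=
  GRing.ZmodClosed.clone R (@Num.int_num_subdef R) _.

Definition circle (R : realType) : zmodType := Quotient.quot (int_subgroup R).

Definition to_circle (R : realType) (t : R) : circle R :=
  \pi_(Quotient.quot (int_subgroup R)) t.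

(* C^(k+eps) on the line. Only |s - t| <= 1 matters in the Hoelder bound: for
   1-periodic functions this is no restriction, and it makes the condition
   meaningful (also for k = 0) for lifts of circle maps, which grow linearly. *)
Definition C_holder (R : realType) (k : nat) (eps : R) (g : R -> R) : Prop :=
  [/\ forall i, (i < k)%N -> forall t, derivable (derive1n i g) t 1,
      continuous (derive1n k g) &
      exists K : R, forall s t, `|s - t| <= 1 ->
        `|derive1n k g s - derive1n k g t| <= K * `|s - t| `^ eps].

Definition C_holder_fun (R : realType) (k : nat) (eps : R)
  (v : circle R -> R) : Prop := C_holder k eps (v \o @to_circle R).

Definition is_lift (R : realType) (f : circle R -> circle R) (F : R -> R) :
  Prop := continuous F /\ forall t, f (to_circle t) = to_circle (F t).

Definition C_holder_map (R : realType) (k : nat) (eps : R)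
  (f : circle R -> circle R) : Prop :=
  exists2 F, is_lift f F & C_holder k eps F.

(* Independent of the choice of the lift and of the representative of x: see
   circle_deriv_lift below. *)
Definition circle_deriv (R : realType) (f : circle R -> circle R)
  (x : circle R) : R := derive1 (get [set F | is_lift f F]) (repr x).

Definition expanding (R : realType) (f : circle R -> circle R) : Prop :=
  exists2 lambda : R, 1 < lambda & forall x, lambda < `|circle_deriv f x|.

Definition weierstrass (R : realType) (f : circle R -> circle R)
  (v : circle R -> R) (y : circle R) : R :=
  - limn (fun N =>
    \sum_(1 <= n < N) v (iter n.-1 f y) / circle_deriv (iter n f) y).

Definition zygmund (R : realType) (a : circle R -> R) : Prop :=
  exists2 C : R, 0 < C &
    forall (x : circle R) (h : R), `|h| <= 1 ->
      `|a (x + to_circle h) + a (x - to_circle h) - 2 * a x| <= C * `|h|.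

Lemma to_circle_eq (R : realType) (s t : R) :
  (to_circle s = to_circle t) <-> (s - t \is a Num.int).
Proof.
have := Quotient.idealrBE (int_subgroup R) s t; rewrite /to_circle => ->.
by split => [->|/eqP].
Qed.

Lemma continuous_int_cst (R : realType) (g : R -> R) :
  continuous g -> (forall t, g t \is a Num.int) -> forall s t, g s = g t.
Proof.
move=> cg ig.
suff main (s t : R) : s <= t -> g s = g t.
  by move=> s t; case: (leP s t) => [/main|/ltW/main].
move=> st; apply/eqP/negPn/negP => gst.
pose m := Num.min (g s) (g t); pose M := Num.max (g s) (g t).
have mi : m \is a Num.int by rewrite /m; case: (leP (g s) (g t)).
have Mi : M \is a Num.int by rewrite /M; case: (leP (g s) (g t)).
have mM : m < M by rewrite /m /M; case: (ltgtP (g s) (g t)) gst => //= ->; rewrite eqxx.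
have mM1 : m + 1 <= M.
  case/intrP: mi mM => a ->; case/intrP: Mi => b ->.
  by rewrite ltr_int -[1]/(1%:~R) -intrD ler_int lezD1.
have [||c _ gc] := @IVT R g s t (m + 2^-1) st.
- exact: continuous_subspaceT.
- by rewrite -/m -/M; apply/andP; split; lra.
have := ig c; rewrite gc => /intrP[b hb]; case/intrP: mi => a ma.
have e : ((b - a)%:~R : R) = 2^-1 by rewrite intrB -hb -ma; lra.
have : (0 < (b - a)%:~R :> R) by rewrite e; lra.
have : ((b - a)%:~R < 1%:~R :> R) by rewrite e; lra.
by rewrite ltr0z ltr_int; case: (b - a) => [[|[|n]]|n].
Qed.

Lemma circle_deriv_lift (R : realType) (f : circle R -> circle R) (F : R -> R)
  (t : R) : is_lift f F -> circle_deriv f (to_circle t) = derive1 F t.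
Proof.
move=> lF; rewrite /circle_deriv.
set G := get _; set u := repr _.
have [cG lG] : is_lift f G by exact: (@getI _ [set F | is_lift f F] F).
have [cF lF'] := lF.
have ut : to_circle u = to_circle t by rewrite /u /to_circle reprK.
have /continuous_int_cst cst : continuous (fun x => G (x + (u - t)) - F x).
  move=> x; apply: cvgB; last exact: cF.
  apply: (@cvg_comp _ _ _ (fun x => x + (u - t)) G); last exact: cG.
  by apply: cvgD; [exact: cvg_id | exact: cvg_cst].
have GF x : G (x + (u - t)) = F x + (G u - F t).
  have -> : G u = G (t + (u - t)) by rewrite addrC subrK.
  apply/eqP; rewrite [eqbRHS]addrC -subr_eq; apply/eqP; apply: cst => y.
  apply/to_circle_eq; rewrite -lG -lF'; congr f.
  apply/to_circle_eq; rewrite (_ : y + _ - y = u - t); first exact/to_circle_eq.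
  by rewrite addrAC subrr add0r.
rewrite !derive1E /derive.
do 2 f_equal; apply/funext => h /=; congr (_ *: _).
have -> : h *: (1 : R) + u = (h *: (1 : R) + t) + (u - t).
  by rewrite -addrA [t + _]addrC subrK.
by rewrite GF; lra.
Qed.

(* Main.v *)
Require Import Defs.
From mathcomp Require Import all_boot all_order all_algebra.
From mathcomp Require Import all_classical all_reals all_analysis.
From mathcomp Require Import ring lra.
Import Order.TTheory GRing.Theory Num.Theory numFieldNormedType.Exports.
Local Open Scope ring_scope.

(** Lift everything to the line: let [F] be a lift of [f], [u] its derivative
    and [w] the function [v] read on the line. The partial sums [A n] of the
    series defining alpha obey the cohomological equation
    [u * A (n + 1) = A n \o F - w], starting from [A 0 = 0]
    ([weierstrass_sumS]), and they converge pointwise to alpha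
    ([cvg_weierstrass_sum]). It is therefore enough to bound the second
    differences of [A n] by [C * h] with [C] independent of [n]
    ([recursion_diff2_le]).

    The [A n] are uniformly bounded, because [`|u| >= lambda > 1]
    ([recursion_bounded]). They are also uniformly Hoelder with exponent
    [(1 + eps) / 2]: one step of the recursion multiplies a small scale by [u]
    and divides the values by [u], which contracts the Hoelder constant for an
    exponent below 1 ([recursion_holder]).

    For second differences, write [h] for the absolute value of the step. The
    Leibniz rule [diff2M], applied to [u * A (n + 1)], gives at [x]

      [u x * diff2 (A (n + 1)) x h
         = diff2 (A n) (F x) (u x * h) + O(h `^ (1 + eps))].

    The error collects the second differences of [u] and [w], which are
    [O(h `^ (1 + eps))] since their derivatives are eps-Hoelder
    ([holder_derivative_diff2]); the products of first differences, Lipschitz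
    times Hoelder; and the replacement of [F (x + h)] and [F (x - h)] by the
    symmetric points [F x + u x * h] and [F x - u x * h], a displacement
    [O(h ^+ 2)] that the Hoelder exponent [(1 + eps) / 2] turns into
    [O(h `^ (1 + eps))]. This is where the regularity of order 2 + eps of [f]
    and of order 1 + eps of [v] enters. The main term preserves a bound
    [C * h] exactly, and the errors, being of order strictly larger than 1,
    sum geometrically along the scales [h, u h, u ^+ 2 h] and so on up to 1.
    The induction expresses this sum by carrying the sharper bound
    [C * h - D * h `^ (1 + eps)]. *)

(** * Second differences and powers *)

Definition diff2 {R : realType} (g : R -> R) (x h : R) : R :=
  g (x + h) + g (x - h) - 2 * g x.

(** A Leibniz rule: the cross terms are products of two first differences,
    hence of higher order than either factor. *)
Lemma diff2M {R : realType} (p q : R -> R) (x h : R) :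
  diff2 (fun t => p t * q t) x h =
  p x * diff2 q x h + q x * diff2 p x h
  + (p (x + h) - p x) * (q (x + h) - q x)
  + (p (x - h) - p x) * (q (x - h) - q x).
Proof. rewrite /diff2; ring. Qed.

Lemma ler_powRl {R : realType} (r x y : R) :
  0 <= r -> 0 <= x -> x <= y -> x `^ r <= y `^ r.
Proof.
by move=> r0 x0 xy; apply: ge0_ler_powR; rewrite ?nnegrE // (le_trans x0).
Qed.

Lemma powR1D {R : realType} (x r : R) : 0 < r -> 0 <= x ->
  x `^ (1 + r) = x * x `^ r.
Proof.
move=> r0 x0; rewrite powRD ?powRr1 //.
by apply/implyP => /eqP e; exfalso; lra.
Qed.

Lemma powR_gt1 {R : realType} (x r : R) : 0 < r -> 1 < x -> 1 < x `^ r.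
Proof.
move=> r0 x1; rewrite -[ltLHS](congr1 (fun g => g r) (@powR1 R)).
by apply: gt0_ltr_powR; rewrite ?nnegrE ?ler01 // ltW // (lt_trans _ x1).
Qed.

Lemma powR_le1 {R : realType} (x r : R) :
  0 <= r -> 0 <= x -> x <= 1 -> x `^ r <= 1.
Proof.
move=> r0 x0 x1; rewrite -[leRHS](congr1 (fun g => g r) (@powR1 R)).
exact: ler_powRl.
Qed.

(** * The recursion u * A (n + 1) = A n \o F - w *)

Section CohomologicalEquation.
Context {R : realType} {eps lambda Lambda K W : R} {F u w : R -> R}
  {A : nat -> R -> R}.

Hypothesis eps01 : 0 < eps < 1.
Hypothesis lambda_gt1 : 1 < lambda.
Hypothesis K_ge1 : 1 <= K.
Hypothesis u_ge : forall t, lambda <= `|u t|.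
Hypothesis u_le : forall t, `|u t| <= Lambda.
Hypothesis w_le : forall t, `|w t| <= W.
Hypothesis u_lip : forall s t, `|u t - u s| <= K * `|t - s|.
Hypothesis w_lip : forall s t, `|w t - w s| <= K * `|t - s|.
Hypothesis F_taylor : forall s t,
  `|F t - F s - u s * (t - s)| <= K * (`|t - s| * `|t - s|).
Hypothesis u_diff2 : forall x h, `|h| <= 1 ->
  `|diff2 u x h| <= K * (`|h| * `|h| `^ eps).
Hypothesis w_diff2 : forall x h, `|h| <= 1 ->
  `|diff2 w x h| <= K * (`|h| * `|h| `^ eps).
Hypothesis A0 : forall t, A 0%N t = 0.
Hypothesis A_step : forall n t, u t * A n.+1 t = A n (F t) - w t.

(** The expansion of [u] beats the forcing: [M = (M + W) / lambda] is a fixed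
    point of the bound that the recursion propagates. *)
Lemma recursion_bounded : exists2 M : R, 0 <= M & forall n t, `|A n t| <= M.
Proof.
have lt1l := lambda_gt1.
have l1 : 0 < lambda - 1 by lra.
have W0 : 0 <= W := le_trans (normr_ge0 _) (w_le 0).
have [M ML] : exists M, M * (lambda - 1) = W.
  by exists (W / (lambda - 1)); rewrite divfK // gt_eqF.
have M0 : 0 <= M by rewrite -(pmulr_lge0 M l1) ML.
exists M => //; elim=> [|n IH] t; first by rewrite A0 normr0.
have e : `|u t| * `|A n.+1 t| <= M + W.
  rewrite -normrM A_step (le_trans (ler_normB _ _)) // lerD //.
have h : lambda * `|A n.+1 t| <= M + W.
  by rewrite (le_trans _ e) // ler_wpM2r.
rewrite -(ler_pM2l (lt_trans ltr01 lambda_gt1)); lra.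
Qed.

(** Passing from step [n] to [n.+1] composes with [F], which stretches small
    distances by about [`|u t|], and divides by [u t]. On beta-Hoelder
    constants the net effect is a factor close to [`|u t| `^ (beta - 1)], at
    most [lambda `^ (beta - 1) < 1]; larger distances are settled by
    boundedness. This works for every [beta < 1]; the exponent chosen here is
    the one for which a quadratic displacement [h ^+ 2] of the argument costs
    [h `^ (1 + eps)]. *)
Lemma recursion_holder : exists2 H : R, 0 <= H &
  forall n s t, `|A n t - A n s| <= H * `|t - s| `^ ((1 + eps) / 2).
Proof.
have [[eps0 eps1] lt1l le1K] := And3 (andP eps01) lambda_gt1 K_ge1.
have [M M0 A_le] := recursion_bounded.
have [beta betaE] : exists b, b = (1 + eps) / 2 by exists ((1 + eps) / 2).
rewrite -betaE.
have b0 : 0 < beta by lra.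
have b1 : 0 < 1 - beta by lra.
pose c := lambda `^ (1 - beta).
have c1 : 1 < c by exact: powR_gt1.
(* At scale delta the distortion 1 + K * delta of F eats at most half of the
   gain c. *)
pose delta := Num.min 1 ((c - 1) / (2 * K)).
have d0 : 0 < delta.
  by rewrite lt_min ltr01 /= divr_gt0 ?mulr_gt0 //; lra.
have Kd : K * delta <= (c - 1) / 2.
  have -> : (c - 1) / 2 = K * ((c - 1) / (2 * K)) by field; lra.
  by rewrite ler_pM2l ?ge_min ?lexx ?orbT //; lra.
have d1 : delta <= 1 by rewrite ge_min lexx.
(* H1 pays for the errors of the recursion at small scale, H2 for large
   distances. *)
pose H1 := 2 * K * (1 + M) / (c - 1).
pose H2 := 2 * M / delta `^ beta.
have H10 : 0 <= H1.
  by rewrite /H1 divr_ge0 ?mulr_ge0 //; lra.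
have H20 : 0 <= H2 by rewrite /H2 divr_ge0 ?powR_ge0 ?mulr_ge0.
have H1E : H1 * (c - 1) = 2 * K * (1 + M) by rewrite /H1 divfK //; lra.
exists (H1 + H2); first exact: addr_ge0.
elim=> [|n IH] s t.
  by rewrite !A0 subrr normr0 mulr_ge0 ?powR_ge0 // addr_ge0.
set d := `|t - s|; set D := d `^ beta.
have dge0 : 0 <= d by exact: normr_ge0.
have D0 : 0 <= D by exact: powR_ge0.
have [dd|dd] := leP delta d.
  have : `|A n.+1 t - A n.+1 s| <= 2 * M.
    rewrite (le_trans (ler_normB _ _)) //.
    have := A_le n.+1 t; have := A_le n.+1 s; lra.
  move/le_trans; apply.
  have -> : 2 * M = H2 * delta `^ beta.
    by rewrite /H2 divfK // gt_eqF // powR_gt0.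
  apply: ler_pM; rewrite ?powR_ge0 //; first by rewrite lerDr.
  by apply: ler_powRl => //; exact: ltW.
have dD : d <= D.
  have [->|dn0] := eqVneq d 0; first exact: powR_ge0.
  apply: ger1_powR; last by lra.
  by rewrite lt_neqAle eq_sym dn0 dge0 /=; lra.
(* Since U = P * U `^ (1 - beta), dividing P by U gains the factor c. *)
set U := `|u t|; set P := U `^ beta.
have Ul : lambda <= U by exact: u_ge.
have P1 : 1 <= P by apply/ltW/powR_gt1; lra.
have PU : P * c <= U.
  have -> : U = P * U `^ (1 - beta).
    by rewrite -powRD ?subrKC ?powRr1 ?oner_eq0 //; lra.
  rewrite ler_wpM2l ?powR_ge0 //; apply: ler_powRl => //; lra.
have FP : `|F t - F s| `^ beta <= P * (1 + K * delta) * D.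
  have h1 : `|F t - F s| <= U * (1 + K * delta) * d.
    have e : F t - F s = u t * (t - s) - (F s - F t - u t * (s - t)) by ring.
    rewrite e (le_trans (ler_normB _ _)) // normrM.
    have := F_taylor t s; rewrite (distrC s t) -/d -/U => h.
    have : K * (d * d) <= U * (K * delta * d).
      rewrite -[leLHS]mul1r ler_pM //; [|lra|].
        by rewrite !mulr_ge0 //; lra.
      by rewrite mulrA ler_wpM2r // ler_wpM2l //; lra.
    lra.
  have Kd0 : 0 <= K * delta by rewrite mulr_ge0 //; lra.
  rewrite (le_trans (ler_powRl _ _ _ (ltW b0) (normr_ge0 _) h1)) //.
  rewrite !powRM ?mulr_ge0 ?addr_ge0 ?normr_ge0 // -/P -/D.
  rewrite ler_wpM2r // ler_wpM2l ?powR_ge0 //.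
  by apply: ler1_powR; lra.
set X := `|A n.+1 t - A n.+1 s|.
have X0 : 0 <= X by exact: normr_ge0.
set Q := (H1 + H2) * (1 + K * delta) + K * (1 + M).
have UX : U * X <= P * D * Q.
  have e : u t * (A n.+1 t - A n.+1 s) =
    (A n (F t) - A n (F s)) - ((w t - w s) + (u t - u s) * A n.+1 s).
    rewrite mulrBr A_step.
    have -> : A n (F s) = u s * A n.+1 s + w s by rewrite A_step subrK.
    ring.
  rewrite /U /X -normrM e (le_trans (ler_normB _ _)) //.
  have h1 : `|A n (F t) - A n (F s)| <= (H1 + H2) * (P * (1 + K * delta) * D).
    by rewrite (le_trans (IH _ _)) // ler_wpM2l // addr_ge0.
  have h2 : `|(w t - w s) + (u t - u s) * A n.+1 s| <= P * (K * (1 + M) * D).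
    rewrite (le_trans (ler_normD _ _)) // normrM.
    have a1 : `|u t - u s| * `|A n.+1 s| <= K * d * M.
      by rewrite ler_pM // ?A_le ?u_lip.
    have a2 := w_lip s t; rewrite -/d in a2.
    have a3 : K * (1 + M) * d <= P * (K * (1 + M) * D).
      rewrite -[leLHS]mul1r ler_pM //; first by rewrite !mulr_ge0 //; lra.
      by rewrite ler_wpM2l // mulr_ge0 //; lra.
    lra.
  rewrite (le_trans (lerD h1 h2)) // /Q.
  lra.
have cX : c * X <= D * Q.
  have P0 : 0 < P by lra.
  rewrite -(ler_pM2l P0) mulrA.
  by rewrite (le_trans _ (le_trans UX _)) ?mulrA // ler_wpM2r.
have Qc : Q <= c * (H1 + H2).
  have : (H1 + H2) * (K * delta) <= (H1 + H2) * ((c - 1) / 2).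
    by rewrite ler_wpM2l // addr_ge0.
  have : 0 <= H2 * (c - 1) by rewrite mulr_ge0 //; lra.
  rewrite /Q; lra.
have c0 : 0 < c by lra.
rewrite -(ler_pM2l c0) (le_trans cX) // mulrA [leRHS]mulrC ler_wpM2l //.
Qed.

(** By [diff2M] and the recursion, [u x * diff2 (A n.+1) x h] equals
    [diff2 (A n) (F x) (u x * h)] up to an error [E * h `^ (1 + eps)]. The
    exponent 1 is neutral: multiplying [h] by [u x] and dividing the result by
    [u x] cancel, so an induction on a bound [C * h] alone would accumulate one
    error per step. The bound that reproduces itself is
    [C * h - D * h `^ (1 + eps)]: in the second term the scale grows by at
    least [lambda `^ eps > 1] at each step, which leaves room for the error. *)
Lemma recursion_diff2_le : exists C : R,
  forall n x h, `|h| <= 1 -> `|diff2 (A n) x h| <= C * `|h|.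
Proof.
have [[eps0 eps1] lt1l le1K] := And3 (andP eps01) lambda_gt1 K_ge1.
have [M M0 A_le] := recursion_bounded.
have [H H0 AH] := recursion_holder.
have [beta betaE] : exists b, b = (1 + eps) / 2 by exists ((1 + eps) / 2).
rewrite -betaE in AH.
have b0 : 0 < beta by lra.
have l0 : 0 < lambda by lra.
pose E := 2 * (H * K `^ beta) + K + K * M + 2 * (K * H).
have E0 : 0 <= E.
  by rewrite /E !addr_ge0 ?mulr_ge0 ?powR_ge0 //; lra.
have le1 : 1 < lambda `^ eps by exact: powR_gt1.
(* D is the fixed point of D * lambda `^ eps = D + E. *)
pose D := E / (lambda `^ eps - 1).
have D0 : 0 <= D by rewrite /D divr_ge0 //; lra.
have DE : D * (lambda `^ eps - 1) = E by rewrite /D divfK //; lra.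
clearbody D.
have L0 : 0 < Lambda by have := u_ge 0; have := u_le 0; lra.
pose C := D + 4 * M * Lambda.
have C0 : 0 <= 4 * M * Lambda by rewrite !mulr_ge0 // ltW.
have absorb y : 0 <= y -> y <= 1 -> y * y `^ eps <= y.
  move=> y0 y1; rewrite -[leRHS]mulr1 ler_wpM2l //.
  by apply: powR_le1; lra.
exists C => n x h h1.
apply: (@le_trans _ _ (C * `|h| - D * (`|h| * `|h| `^ eps))); last first.
  by rewrite gerBl !mulr_ge0 ?powR_ge0.
elim: n x h h1 => [|n IH] x h h1.
  rewrite /diff2 !A0 addr0 mulr0 subrr normr0 subr_ge0 /C.
  have : D * (`|h| * `|h| `^ eps) <= D * `|h| by rewrite ler_wpM2l ?absorb.
  have : 0 <= 4 * M * Lambda * `|h| by rewrite mulr_ge0.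
  lra.
set y := `|h| in h1 *; have y0 : 0 <= y by exact: normr_ge0.
(* When the image scale U * y exceeds 1 the induction hypothesis is void, but
   then y is at least 1 / Lambda and boundedness suffices. *)
set U := `|u x|; have Ul : lambda <= U by exact: u_ge.
have [Uy|Uy] := leP (U * y) 1; last first.
  have : `|diff2 (A n.+1) x h| <= 4 * M.
    have := A_le n.+1 (x + h); have := A_le n.+1 (x - h).
    have := A_le n.+1 x.
    rewrite /diff2 !ler_norml => /andP[a1 a2] /andP[a3 a4] /andP[a5 a6].
    by apply/andP; split; lra.
  move/le_trans; apply.
  have h2 : D * (y * y `^ eps) <= D * y by rewrite ler_wpM2l ?absorb.
  have h3 : 4 * M * 1 <= 4 * M * (Lambda * y).
    rewrite ler_wpM2l ?mulr_ge0 // (le_trans (ltW Uy)) // ler_wpM2r //.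
    exact: u_le.
  rewrite /C; lra.
set G := y * y `^ eps.
have G0 : 0 <= G by rewrite mulr_ge0 ?powR_ge0.
(* F (x + z) and F x + u x * z differ by O(y ^+ 2): this replaces the image of
   a symmetric triple by a symmetric one. *)
have Fside z : `|z| = y -> `|A n (F (x + z)) - A n (F x + u x * z)|
    <= H * K `^ beta * G.
  move=> zy.
  rewrite (le_trans (AH _ _ _)) // -mulrA ler_wpM2l //.
  have := F_taylor x (x + z); rewrite (addrC x z) addrK zy -opprB => h2.
  have -> : G = y `^ beta * y `^ beta.
    rewrite -powRD; last by apply/implyP => /eqP; lra.
    by rewrite /G -powR1D ?betaE -?splitr //; lra.
  rewrite -!powRM ?mulr_ge0 //; try lra.
  apply: ler_powRl; rewrite ?(ltW b0) //.
  by rewrite (le_trans _ h2) // opprB opprD addrA.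
have prodside z : `|z| = y ->
    `|(u (x + z) - u x) * (A n.+1 (x + z) - A n.+1 x)| <= K * H * G.
  move=> zy; rewrite normrM.
  have -> : K * H * G = (K * y) * (H * y `^ eps) by rewrite /G; ring.
  have a1 := u_lip x (x + z); have a2 := AH n.+1 x (x + z).
  rewrite (addrC x z) addrK zy in a1 a2.
  rewrite (addrC x z) ler_pM // (le_trans a2) // ler_wpM2l //.
  have [->|yn0] := eqVneq y 0.
    by rewrite !powR0 //; lra.
  apply: ger_powR; last by lra.
  by rewrite lt_neqAle eq_sym yn0 y0.
have step : U * `|diff2 (A n.+1) x h| <=
    `|diff2 (A n) (F x) (u x * h)| + E * G.
  have e1 : u x * diff2 (A n.+1) x h =
      diff2 (A n) (F x) (u x * h)
      + ((A n (F (x + h)) - A n (F x + u x * h))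
         + (A n (F (x + - h)) - A n (F x + u x * - h))
         - diff2 w x h - A n.+1 x * diff2 u x h
         - (u (x + h) - u x) * (A n.+1 (x + h) - A n.+1 x)
         - (u (x + - h) - u x) * (A n.+1 (x + - h) - A n.+1 x)).
    have e : diff2 (fun t => u t * A n.+1 t) x h =
        diff2 (A n \o F) x h - diff2 w x h.
      by rewrite /diff2 /= !A_step; ring.
    have {e} -> : u x * diff2 (A n.+1) x h = diff2 (A n \o F) x h
        - diff2 w x h - A n.+1 x * diff2 u x h
        - (u (x + h) - u x) * (A n.+1 (x + h) - A n.+1 x)
        - (u (x - h) - u x) * (A n.+1 (x - h) - A n.+1 x).
      by rewrite -e diff2M; ring.
    rewrite [diff2 (A n \o F) x h]/diff2 [diff2 (A n) _ _]/diff2 /= mulrN.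
    ring.
  have hN : `|- h| = y by rewrite normrN.
  have b1 := Fside h erefl; have b2 := Fside _ hN.
  have b3 := prodside h erefl; have b4 := prodside _ hN.
  have b5 := w_diff2 x h h1; have b6 : `|A n.+1 x * diff2 u x h| <= M * (K * G).
    by rewrite normrM ler_pM ?A_le ?u_diff2.
  rewrite -[U * _]normrM e1 (le_trans (ler_normD _ _)) // lerD2l.
  rewrite -/y -/G in b5.
  move: b1 b2 b3 b4 b5 b6; rewrite !ler_norml /E.
  move=> /andP[? ?] /andP[? ?] /andP[? ?] /andP[? ?] /andP[? ?] /andP[? ?].
  by apply/andP; split; lra.
have U0 : 0 < U by lra.
rewrite -(ler_pM2l U0) (le_trans step) //.
have IHx := IH (F x) (u x * h); rewrite normrM -/U -/y in IHx.
have {}IHx := IHx Uy.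
have h2 : D * (U * (lambda `^ eps * G)) <= D * (U * y * (U * y) `^ eps).
  rewrite ler_wpM2l // /G powRM //; last exact: ltW.
  have -> : U * y * (U `^ eps * y `^ eps) = U * (U `^ eps * (y * y `^ eps)).
    ring.
  rewrite ler_wpM2l ?(ltW U0) // ler_wpM2r //.
  by apply: ler_powRl; lra.
have h3 : E * G <= U * (E * G) by rewrite ler_peMl ?(mulr_ge0 E0 G0) //; lra.
have h4 : U * (D * (lambda `^ eps - 1) * G) = U * (E * G) by rewrite DE.
lra.
Qed.

End CohomologicalEquation.

(** * Consequences of the mean value theorem *)

Lemma mean_value {R : realType} (p : R -> R) (s t : R) :
  (forall x, derivable p x 1) ->
  exists2 c, `|c - s| <= `|t - s| & p t - p s = derive1 p c * (t - s).
Proof.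
move=> dp.
have key a b : a <= b ->
    exists2 c, a <= c <= b & p b - p a = derive1 p c * (b - a).
  move=> ab; have [||c] := @MVT_segment R p (derive1 p) a b ab.
  - by move=> x _; rewrite derive1E; exact/derivableP.
  - by apply: derivable_within_continuous.
  - by rewrite in_itv /= => c_in e; exists c.
have [st|ts] := leP s t.
  have [c /andP[c1 c2] e] := key s t st; exists c => //.
  by rewrite !ger0_norm; lra.
have [c /andP[c1 c2] e] := key t s (ltW ts); exists c.
  by rewrite !ler0_norm; lra.
by rewrite -(opprB s) mulrN -e opprB.
Qed.

Lemma derivative_lipschitz {R : realType} (p : R -> R) (B : R) :
  (forall x, derivable p x 1) -> (forall x, `|derive1 p x| <= B) ->
  forall s t, `|p t - p s| <= B * `|t - s|.
Proof.
move=> dp pB s t; have [c _ ->] := mean_value p s t dp.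
by rewrite normrM ler_wpM2r.
Qed.

Lemma derivative_lipschitz_taylor {R : realType} (p : R -> R) (B : R) :
  (forall x, derivable p x 1) ->
  (forall s t, `|derive1 p t - derive1 p s| <= B * `|t - s|) ->
  0 <= B ->
  forall s t, `|p t - p s - derive1 p s * (t - s)| <= B * (`|t - s| * `|t - s|).
Proof.
move=> dp pB B0 s t; have [c cs ->] := mean_value p s t dp.
rewrite -mulrBl normrM mulrA ler_wpM2r // (le_trans (pB _ _)) //.
by rewrite ler_wpM2l.
Qed.

(** The linear parts of the two increments of [p] at [x] cancel, and each
    remainder is [h] times an oscillation of the derivative over length [h]. *)
Lemma holder_derivative_diff2 {R : realType} (p : R -> R) (eps B : R) :
  0 <= eps -> 0 <= B -> (forall x, derivable p x 1) ->
  (forall s t, `|s - t| <= 1 ->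
     `|derive1 p s - derive1 p t| <= B * `|s - t| `^ eps) ->
  forall x h, `|h| <= 1 ->
    `|diff2 p x h| <= 2 * B * (`|h| * `|h| `^ eps).
Proof.
move=> eps0 B0 dp pB x h h1.
have side z : `|z| = `|h| ->
    `|p (x + z) - p x - derive1 p x * z| <= B * (`|h| * `|h| `^ eps).
  move=> zh; have [c] := mean_value p x (x + z) dp.
  have -> : x + z - x = z by ring.
  move=> cx ->; rewrite -mulrBl normrM mulrCA zh.
  rewrite mulrC ler_wpM2l //.
  rewrite (le_trans (pB _ _ _)) //; first by rewrite (le_trans cx) // zh.
  by rewrite ler_wpM2l // ler_powRl // (le_trans cx) // zh.
have a := side h erefl; have b := side (- h) (normrN h).
have -> : diff2 p x h = (p (x + h) - p x - derive1 p x * h)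
  + (p (x + - h) - p x - derive1 p x * - h) by rewrite /diff2; ring.
by rewrite (le_trans (ler_normD _ _)) //; lra.
Qed.

(** * Periodic functions, the circle and iterated lifts *)

Lemma periodic_bounded {R : realType} (g : R -> R) :
  continuous g -> (forall t (m : int), g (t + m%:~R) = g t) ->
  exists B, forall t, `|g t| <= B.
Proof.
move=> cg pg.
have cng : {within `[0, 1], continuous (fun t => `|g t|)}%classic.
  apply: continuous_subspaceT => t; apply: cvg_norm; exact: cg.
have [c _ gc] := EVT_max (@ler01 R) cng.
exists `|g c| => t.
rewrite -(pg t (- Num.floor t)); apply: gc.
rewrite in_itv /= intrN.
have := floor_le t; have := floorD1_gt t; rewrite intrD => h1 h2.
by apply/andP; split; lra.
Qed.

Lemma derive1_periodic {R : realType} (g : R -> R) (a : R) :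
  (forall t, g (t + a) = g t) -> forall t, derive1 g (t + a) = derive1 g t.
Proof.
move=> pg t; rewrite !derive1E /derive; do 2 f_equal.
apply/funext => h /=; congr (_ *: _); rewrite addrA !pg //.
Qed.

Lemma derivable_continuous {R : realType} (g : R -> R) :
  (forall x, derivable g x 1) -> continuous g.
Proof. by move=> dg x; apply/differentiable_continuous/derivable1_diffP. Qed.

Lemma to_circleD {R : realType} (s t : R) :
  to_circle (s + t) = to_circle s + to_circle t.
Proof. by rewrite /to_circle raddfD. Qed.

Lemma to_circleB {R : realType} (s t : R) :
  to_circle (s - t) = to_circle s - to_circle t.
Proof. by rewrite /to_circle raddfB. Qed.

Lemma to_circle_int {R : realType} (t : R) (m : int) :
  to_circle (t + m%:~R) = to_circle t.
Proof.
by apply/to_circle_eq; rewrite addrC addrA addNr add0r intr_int.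
Qed.

Lemma is_lift_iter {R : realType} (f : circle R -> circle R) (F : R -> R) n :
  is_lift f F -> is_lift (iter n f) (iter n F).
Proof.
case=> cF fF; elim: n => [|n [cn fn]]; first by split=> // t; exact: cvg_id.
split=> [t|t /=]; last by rewrite fn fF.
exact: (cvg_comp _ _ (cn t) (cF (iter n F t))).
Qed.

Lemma derivable_iter {R : realType} (F : R -> R) n :
  (forall x, derivable F x 1) -> forall x, derivable (iter n F) x 1.
Proof.
move=> dF; elim: n => [|n IH] x; first exact: derivable_id.
apply/derivable1_diffP; apply: (@differentiable_comp _ _ _ _ (iter n F) F).
  exact/derivable1_diffP.
exact/derivable1_diffP.
Qed.

Lemma derive1_iterSr {R : realType} (F : R -> R) n x :
  (forall x, derivable F x 1) ->
  derive1 (iter n.+1 F) x = derive1 (iter n F) (F x) * derive1 F x.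
Proof.
move=> dF; rewrite -derive1_comp //; last exact: derivable_iter.
by congr (derive1 _ x); apply/funext => y /=; rewrite -iterSr.
Qed.

(** * The generalized Weierstrass function as a limit *)

(** Summation stops at [n = N] included, so that the sum with index 0 is empty
    and the index agrees with the number of steps of the recursion. *)
Definition weierstrass_sum {R : realType} (F w : R -> R) (N : nat)
    (t : R) : R :=
  - \sum_(1 <= n < N.+1) w (iter n.-1 F t) / derive1 (iter n F) t.

(** The partial sums satisfy the cohomological equation with one term lost:
    the chain rule [derive1_iterSr] takes the factor [F'(t)] out of every
    denominator. *)
Lemma weierstrass_sumS {R : realType} (F w : R -> R) (N : nat) (t : R) :
  (forall x, derivable F x 1) -> derive1 F t != 0 ->
  derive1 F t * weierstrass_sum F w N.+1 t = weierstrass_sum F w N (F t) - w t.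
Proof.
move=> dF u0; rewrite /weierstrass_sum big_ltn // (big_add1 _ _ 1).
rewrite opprD mulrDr mulrN /= mulrCA divff // mulr1 addrC; congr (_ - _).
rewrite mulrN big_distrr /=; congr (- _).
apply: eq_big_nat => -[//|n] _ /=.
rewrite -iterS iterSr (derive1_iterSr F n.+1) //=.
rewrite mulrCA invfM (mulrCA (derive1 F t)) divff // mulr1 //.
Qed.

Lemma derive1_iter_ge {R : realType} (F : R -> R) (lambda : R) n t :
  0 <= lambda -> (forall x, derivable F x 1) ->
  (forall x, lambda <= `|derive1 F x|) ->
  lambda ^+ n <= `|derive1 (iter n F) t|.
Proof.
move=> l0 dF ul; elim: n t => [|n IH] t.
  by rewrite expr0 derive1_id normr1.
by rewrite derive1_iterSr // exprSr normrM ler_pM ?exprn_ge0.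
Qed.

(** The terms are dominated by [W / lambda ^+ n]. *)
Lemma is_cvg_weierstrass_sum {R : realType} (F w : R -> R) (lambda W t : R) :
  1 < lambda -> (forall x, derivable F x 1) ->
  (forall x, lambda <= `|derive1 F x|) -> (forall x, `|w x| <= W) ->
  cvgn (fun N => \sum_(1 <= n < N) w (iter n.-1 F t) / derive1 (iter n F) t).
Proof.
move=> l1 dF ul wW.
have l0 : 0 < lambda by lra.
set T := fun n => w (iter n.-1 F t) / derive1 (iter n F) t.
suff cT : cvgn (series (fun n => T n.+1)).
  apply/cvg_ex; exists (limn (series (fun n => T n.+1))).
  rewrite -cvg_shiftS /=.
  suff -> : (fun N => \sum_(1 <= n < N.+1) T n) = series (fun n => T n.+1).
    by [].
  by apply/funext => N; rewrite big_add1.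
apply: normed_cvg.
apply: (@series_le_cvg _ _ (geometric (W / lambda) lambda^-1)).
- by move=> n /=.
- move=> n; rewrite /geometric /=.
  rewrite mulr_ge0 ?divr_ge0 ?exprn_ge0 ?invr_ge0 ?(ltW l0) //.
  exact: le_trans (wW 0).
- move=> n; rewrite /geometric /= /T normrM normfV.
  rewrite -mulrA exprVn -invfM -exprS ler_pM ?invr_ge0 //.
  have := derive1_iter_ge F lambda n.+1 t (ltW l0) dF ul => h.
  by rewrite lef_pV2 ?posrE ?(lt_le_trans _ h) ?exprn_gt0.
- apply: is_cvg_geometric_series; rewrite ger0_norm ?invr_ge0 ?(ltW l0) //.
  by rewrite invf_lt1.
Qed.

Lemma weierstrass_to_circle {R : realType} (f : circle R -> circle R)
    (v : circle R -> R) (F : R -> R) (t : R) :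
  is_lift f F ->
  weierstrass f v (to_circle t) = - limn (fun N =>
    \sum_(1 <= n < N) (v \o @to_circle R) (iter n.-1 F t)
                      / derive1 (iter n F) t).
Proof.
move=> lF; rewrite /weierstrass; congr (- limn _).
apply/funext => N; apply: eq_bigr => n _ /=.
rewrite (circle_deriv_lift _ (is_lift_iter f F n lF)).
by have [_ ->] := is_lift_iter f F n.-1 lF.
Qed.

Lemma cvg_weierstrass_sum {R : realType} (f : circle R -> circle R)
    (v : circle R -> R) (F : R -> R) (lambda W t : R) :
  is_lift f F -> 1 < lambda -> (forall x, derivable F x 1) ->
  (forall x, lambda <= `|derive1 F x|) ->
  (forall x, `|(v \o @to_circle R) x| <= W) ->
  ((fun N => weierstrass_sum F (v \o @to_circle R) N t) @ \oo -->
    weierstrass f v (to_circle t))%classic.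
Proof.
move=> lF l1 dF ul wW; rewrite (weierstrass_to_circle f v F t lF).
apply: cvgN.
have /(@is_cvg_weierstrass_sum _ _ _ _ _ t l1 dF ul) := wW.
by rewrite -cvg_shiftS.
Qed.

(** * The Zygmund estimate *)

Theorem proposition1p1 (R : realType) (eps : R) (heps : 0 < eps < 1)
  (f : circle R -> circle R) (v : circle R -> R)
  (hf : C_holder_map 2 eps f) (hexp : expanding f)
  (hv : C_holder_fun 1 eps v) :
  zygmund (weierstrass f v).
Proof.
have [F lF [dF2 cF2 [K1 hK1]]] := hf.
have [lambda l1 ul] := hexp.
have [dw1 cw1 [K2 hK2]] := hv.
have eps0 : 0 <= eps by case/andP: heps => /ltW.
pose u := derive1 F; pose w := v \o @to_circle R.
have dF : forall x, derivable F x 1 := dF2 0%N isT.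
have du : forall x, derivable u x 1 := dF2 1%N isT.
have dw : forall x, derivable w x 1 := dw1 0%N isT.
(* The derivative of the lift is periodic because it is the derivative of f. *)
have uE t : u t = circle_deriv f (to_circle t).
  by rewrite (circle_deriv_lift _ lF).
have u_per t (m : int) : u (t + m%:~R) = u t by rewrite !uE to_circle_int.
have w_per t (m : int) : w (t + m%:~R) = w t by rewrite /w /= to_circle_int.
have du_per t (m : int) : derive1 u (t + m%:~R) = derive1 u t.
  by apply: derive1_periodic => s; exact: u_per.
have dw_per t (m : int) : derive1 w (t + m%:~R) = derive1 w t.
  by apply: derive1_periodic => s; exact: w_per.
have [Lambda uL] := periodic_bounded u (derivable_continuous _ du) u_per.
have [W wW] := periodic_bounded w (derivable_continuous _ dw) w_per.
have [K3 hK3] := periodic_bounded (derive1 u) cF2 du_per.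
have [K4 hK4] := periodic_bounded (derive1 w) cw1 dw_per.
(* One constant for all the bounds required by [recursion_diff2_le]; the
   factors 2 come from [holder_derivative_diff2]. The Hoelder constants K1 and
   K2 carry no sign, hence the absolute values. *)
pose K := 1 + 2 * `|K1| + 2 * `|K2| + `|K3| + `|K4|.
have [n1 n2 n3 n4] :=
  And4 (normr_ge0 K1) (normr_ge0 K2) (normr_ge0 K3) (normr_ge0 K4).
have [m1 m2 m3 m4] :=
  And4 (ler_norm K1) (ler_norm K2) (ler_norm K3) (ler_norm K4).
have K_ge1 : 1 <= K by rewrite /K; lra.
have u_ge t : lambda <= `|u t| by rewrite uE ltW.
have u_lip s t : `|u t - u s| <= K * `|t - s|.
  apply: derivative_lipschitz => // x.
  by rewrite (le_trans (hK3 x)) // /K; lra.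
have w_lip s t : `|w t - w s| <= K * `|t - s|.
  apply: derivative_lipschitz => // x.
  by rewrite (le_trans (hK4 x)) // /K; lra.
have F_taylor s t : `|F t - F s - u s * (t - s)| <= K * (`|t - s| * `|t - s|).
  by apply: derivative_lipschitz_taylor => //; lra.
have u_diff2 x h : `|h| <= 1 -> `|diff2 u x h| <= K * (`|h| * `|h| `^ eps).
  move=> h1; apply: (@le_trans _ _ (2 * `|K1| * (`|h| * `|h| `^ eps))).
    apply: holder_derivative_diff2 => // s t st.
    by rewrite (le_trans (hK1 s t st)) // ler_wpM2r ?powR_ge0.
  by rewrite ler_wpM2r ?mulr_ge0 ?powR_ge0 // /K; lra.
have w_diff2 x h : `|h| <= 1 -> `|diff2 w x h| <= K * (`|h| * `|h| `^ eps).
  move=> h1; apply: (@le_trans _ _ (2 * `|K2| * (`|h| * `|h| `^ eps))).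
    apply: holder_derivative_diff2 => // s t st.
    by rewrite (le_trans (hK2 s t st)) // ler_wpM2r ?powR_ge0.
  by rewrite ler_wpM2r ?mulr_ge0 ?powR_ge0 // /K; lra.
have sum0 t : weierstrass_sum F w 0 t = 0.
  by rewrite /weierstrass_sum big_geq // oppr0.
have sumS n t :
    u t * weierstrass_sum F w n.+1 t = weierstrass_sum F w n (F t) - w t.
  rewrite weierstrass_sumS // -normr_gt0.
  by have := u_ge t; rewrite /u; lra.
have [C sumC] := recursion_diff2_le heps l1 K_ge1 u_ge uL wW u_lip w_lip
  F_taylor u_diff2 w_diff2 sum0 sumS.
exists (`|C| + 1) => [|x h h1]; first by rewrite ltr_wpDl.
have -> : x = to_circle (repr x) by rewrite /to_circle reprK.
set t := repr x; rewrite -to_circleD -to_circleB.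
have cvg s := cvg_weierstrass_sum f v F lambda W s lF l1 dF u_ge wW.
apply: (cvgr_to_le (cvg_norm
  (cvgB (cvgD (cvg (t + h)) (cvg (t - h))) (cvgM (cvg_cst (2 : R)) (cvg t))))).
near=> N; rewrite (le_trans (sumC N t h h1)) // ler_wpM2r //.
by rewrite (le_trans (ler_norm C)) // lerDl.
Unshelve. all: by end_near.
Qed.
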